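(* Let $n\ge 2$ be an integer. The Jacobi sequence of $e^{1/n}$ (where $e$ is Euler's number) is purely periodic, and its smallest period length is $24$ if $n\equiv 1,3\pmod 4$, $12$ if $n\equiv 2\pmod 4$, and $3$ if $n\equiv 0\pmod 4$.
   Context: For $x\in\mathbb{R}\setminus\mathbb{Q}$ with regular continued fraction expansion $x=[a_0,a_1,a_2,\ldots]$, the convergents $s_k/t_k$ are defined by $s_{-1}=1$, $s_0=a_0$, $s_k=a_ks_{k-1}+s_{k-2}$ and $t_{-1}=0$, $t_0=1$, $t_k=a_kt_{k-1}+t_{k-2}$ for $k\ge1$. For an odd natural number $n$ and an integer $m$ coprime to $n$, $\left(\frac{m}{n}\right)$ is the usual Jacobi symbol (equal to $1$ if $n=1$); if $n$ is even and $\gcd(m,n)=1$, one sets $\left(\frac{m}{n}\right)=*$, a fixed symbol different from $\pm1$. The Jacobi sequence of $x$ is $c_k=\left(\frac{s_k}{t_k}\right)$, $k\ge 0$. It is purely periodic with period length $L\ge1$ if $c_{k+L}=c_k$ for all $k\ge0$; the smallest period length is the least such $L$. *)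

(* Defs.v *)
From HB Require Import structures.
From mathcomp Require Import all_boot all_order all_algebra.
From mathcomp Require Import all_classical all_reals all_analysis.
Set Implicit Arguments. Unset Strict Implicit. Unset Printing Implicit Defensive.
Import Order.TTheory GRing.Theory Num.Theory.
Local Open Scope ring_scope.

(* Regular continued fraction via the Gauss map: x_0 = x, x_{k+1} = 1/(x_k - floor x_k);
   partial quotients a_k = floor x_k.  For irrational x this is the regular CF expansion. *)
Fixpoint cf_rem (R : realType) (x : R) (k : nat) : R :=
  match k with
  | 0%N => x
  | k'.+1 => let y := cf_rem x k' in (y - (Num.floor y)%:~R)^-1
  end.

Definition cf_digit (R : realType) (x : R) (k : nat) : int := Num.floor (cf_rem x k).

Fixpoint cf_conv_aux (R : realType) (x : R) (k : nat) : (int * int) * (int * int) :=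
  match k with
  | 0%N => ((1, cf_digit x 0), (0, 1))
  | k'.+1 =>
      let '((sp, s), (tp, t)) := cf_conv_aux x k' in
      let a := cf_digit x k in
      ((s, a * s + sp), (t, a * t + tp))
  end.

Definition cf_num (R : realType) (x : R) (k : nat) : int := (cf_conv_aux x k).1.2.
Definition cf_den (R : realType) (x : R) (k : nat) : int := (cf_conv_aux x k).2.2.

Definition legendre (m : int) (p : nat) : int :=
  if (p %| `|m|%N)%N then 0
  else if [exists i : 'I_p, ((i * i) %% p)%N == `|(m %% p%:Z)%Z|%N] then 1 else -1.

Definition jacobi (m : int) (n : nat) : int :=
  \prod_(p <- primes n) legendre m p ^+ logn p n.

(* Jacobi sequence value: Some (s_k/t_k) if t_k odd, None plays the role of the symbol '*'. *)
Definition jacobi_seq (R : realType) (x : R) (k : nat) : option int :=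
  let t := `|cf_den x k|%N in
  if odd t then Some (jacobi (cf_num x k) t) else None.

Definition is_period_length (T : Type) (c : nat -> T) (L : nat) : Prop :=
  (1 <= L)%N /\ forall k, c (k + L)%N = c k.

Definition purely_periodic (T : Type) (c : nat -> T) : Prop :=
  exists L, is_period_length c L.

Definition smallest_period_length (T : Type) (c : nat -> T) (L : nat) : Prop :=
  is_period_length c L /\ forall L', is_period_length c L' -> (L <= L')%N.

(* Main.v *)
Require Import Defs.
From HB Require Import structures.
From mathcomp Require Import all_boot all_order all_algebra.
From mathcomp Require Import all_classical all_reals all_analysis.
From mathcomp Require Import fingroup cyclic finfield.
From mathcomp Require Import zify ring lra.
Import Order.TTheory GRing.Theory Num.Theory.
Import numFieldNormedType.Exports.
Local Open Scope ring_scope.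

(* The expansion is e^(1/n) = [1, n-1, 1, 1, 3n-1, 1, 1, 5n-1, 1, ...]: Cohn's integrals
   of x^i (1-x)^j e^(x/n), with (i, j) running through (m, m), (m+1, m), (m, m+1), are
   positive and satisfy the corresponding three-term recurrence, so they are the
   remainders of the Euclidean algorithm applied to (e^(1/n), 1).

   Since s_k t_(k-1) = (-1)^(k-1) modulo t_k, the symbol (s_k / t_k) is
   ((-1)^(k-1) / t_k) (t_(k-1) / t_k).  Inverting the latter symbol when t_k is even, one
   gets a quantity which passing from k to k + 1 multiplies by a sign depending only on
   a_(k+1), t_(k-1), t_k modulo 4, by reciprocity.  Hence the Jacobi sequence is the output
   of a finite automaton driven by the partial quotients modulo 4, which have period 6;
   its state returns after 24 steps, and the least periods are read off one cycle. *)

(** * Quadratic reciprocity *)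

(** With [n = #|F|./2], [x ^+ n] is a sign because its square is 1. The units form a cyclic group of
    order [n.*2], so if this sign is 1, the exponent of [x] as a power of a generator is even. *)
Lemma euler_criterion (F : finFieldType) (x : F) : odd #|F| -> x != 0 ->
  x ^+ #|F|./2 = if [exists y : F, y ^+ 2 == x] then 1 else -1.
Proof.
move=> oddF x0; set n := #|F|./2.
have cF : #|F| = n.*2.+1 by rewrite -[LHS]odd_double_half oddF.
have fermat (y : F) : y != 0 -> y ^+ n.*2 = 1.
  by move=> y0; apply: (mulfI y0); rewrite -exprS -cF expf_card mulr1.
case: ifPn => [/existsP[y /eqP xy]|nsq].
  by rewrite -xy -exprM mul2n fermat //; apply: contraNneq x0 => y0; rewrite -xy y0 expr0n.
have : (x ^+ n) ^+ 2 == 1 by rewrite -exprM muln2 fermat.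
rewrite sqrf_eq1 => /orP[/eqP xn1|/eqP //].
case/negP: nsq.
have /cyclicP[g gE] := field_unit_group_cyclic [set: {unit F}].
have Ux : x \is a GRing.unit by rewrite unitfE.
have : FinRing.unit F Ux \in <[g]>%g by rewrite -gE inE.
case/cycleP => k xk.
have og : #[g]%g = n.*2 by rewrite /order -gE card_finField_unit cF.
have gk1 : (g ^+ (k * n) = 1)%g.
  by apply: val_inj; rewrite expgM -xk /= FinRing.val_unitX.
have n0 : (0 < n)%N.
  rewrite -double_gt0 -og; exact: order_gt0.
have : (n.*2 %| k * n)%N by rewrite -og order_dvdn gk1.
rewrite -mul2n dvdn_pmul2r // => /dvdnP[j kj].
apply/existsP; exists (FinRing.uval (g ^+ j)%g).
by rewrite -FinRing.val_unitX -expgM -kj -xk.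
Qed.

Lemma legendre_euler (p : nat) (m : int) : prime p -> odd p ->
  (legendre m p)%:~R = m%:~R ^+ p./2 :> 'F_p.
Proof.
move=> pp op; have p2 := prime_gt1 pp.
have pF := pchar_Fp pp; rewrite /legendre.
have -> : (p %| `|m|%N)%N = (m%:~R == 0 :> 'F_p) by rewrite -(dvdz_pcharf pF).
case: eqP => [->|/eqP m0].
  by rewrite expr0n; have : (0 < p./2)%N by [lia]; case: (p./2).
have := euler_criterion _ _ _ m0; rewrite card_Fp // => /(_ op) ->.
suff -> : [exists i : 'I_p, ((i * i) %% p)%N == `|(m %% p%:Z)%Z|%N] =
   [exists y : 'F_p, y ^+ 2 == m%:~R] by case: ifP.
have key (i : nat) : (((i * i) %% p)%N == `|(m %% p%:Z)%Z|%N) = ((i%:R : 'F_p) ^+ 2 == m%:~R).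
  rewrite -subr_eq0 expr2 -natrM -[X in X - _]/((i * i)%N%:Z%:~R) -rmorphB.
  rewrite -(dvdz_pcharf pF) -eqz_mod_dvd modz_nat -eqz_nat abszE.
  by rewrite ger0_norm // modz_ge0 //; case: (p) p2.
apply/existsP/existsP => -[i].
  by rewrite key => ?; exists i%:R.
move=> hi; have ip : (i < p)%N by rewrite -[X in (_ < X)%N](Fp_cast pp).
by exists (Ordinal ip); rewrite key /= natr_Zp.
Qed.

Lemma legendre_bound (m : int) (p : nat) : `|legendre m p| <= 1.
Proof. by rewrite /legendre; case: ifP => _; [|case: ifP => _]. Qed.

(** The difference is a multiple of [p] of absolute value at most 2, hence 0. Identities between
    signs thus lift from ['F_p] to the integers. *)
Lemma intr_Fp_inj (p : nat) (a b : int) : prime p -> odd p ->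
  `|a| <= 1 -> `|b| <= 1 -> a%:~R = b%:~R :> 'F_p -> a = b.
Proof.
move=> pp op a1 b1 /eqP; rewrite -subr_eq0 -rmorphB -(dvdz_pcharf (pchar_Fp pp)).
have := prime_gt1 pp => p1 /dvdzP[k kE].
have : (k = 0) \/ (1 <= k) \/ (k <= -1) by lia.
have p3 : (2 < p)%N by case: (p) p1 op => [|[|[|]]].
by case=> [k0|[|]]; [rewrite k0 mul0r in kE; lia|nia|nia].
Qed.

(** Let [f x] be the absolute value of the residue of [q * x] of least absolute value. As [f]
    permutes [1..P], multiplying all [q * x] and cancelling the factorial of [P] leaves [q ^+ P]
    equal to the sign; Euler's criterion concludes. *)
Lemma gauss_lemma (p q : nat) : prime p -> odd p -> ~~ (p %| q)%N ->
  legendre q p = (-1) ^+ (\sum_(1 <= x < p./2.+1) (p./2 < (q * x) %% p))%N.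
Proof.
move=> pp op npq; set P := p./2; have pE : p = P.*2.+1 by rewrite -[LHS]odd_double_half op.
have pF := pchar_Fp pp.
pose r x := ((q * x) %% p)%N; pose f x := if (P < r x)%N then (p - r x)%N else r x.
have rp x : (r x < p)%N by rewrite ltn_mod prime_gt0.
have fE x : (q * x)%:R = (-1) ^+ (P < r x)%N * (f x)%:R :> 'F_p.
  rewrite -(Fp_nat_mod pp) -/(r x) /f; case: ltnP => _; last by rewrite mul1r.
  by rewrite natrB ?(ltnW (rp x)) // pchar_Fp_0 // sub0r mulN1r opprK.
have f_inj : {in iota 1 P &, injective f}.
  move=> x y; rewrite !mem_iota => xP yP fxy.
  (* Squaring removes the sign in [fE], so [x] is [y] or [-y] modulo [p]; the latter is excluded by
     [0 < x + y < p]. *)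
  have : ((q * x)%:R : 'F_p) ^+ 2 == (q * y)%:R ^+ 2.
    by rewrite !fE !exprMn -!exprM ![(_ * 2)%N]mulnC !exprM !sqrrN !expr1n fxy.
  rewrite eqf_sqr -subr_eq0 -addr_eq0 -natrD.
  rewrite -mulnDr -(dvdn_pcharf pF) Euclid_dvdM // (negbTE npq) /=.
  rewrite [(p %| x + y)%N]gtnNdvd ?orbF; [|lia|lia].
  rewrite !natrM -mulrBr mulf_eq0 -(dvdn_pcharf pF) (negbTE npq) /=.
  wlog xy : x y xP yP fxy / (x <= y)%N.
    move=> H; case: (leqP x y) => [|/ltnW] yx; first exact: H.
    by rewrite -oppr_eq0 opprB => h; apply/esym/H.
  rewrite -oppr_eq0 opprB -natrB // -(dvdn_pcharf pF).
  by case: (posnP (y - x)) => [|yx]; [lia|rewrite gtnNdvd //; lia].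
have f_in x : x \in iota 1 P -> f x \in iota 1 P.
  rewrite !mem_iota => xP; have : (r x != 0)%N.
    rewrite /r -/(p %| q * x)%N Euclid_dvdM // negb_or npq /= gtnNdvd //; lia.
  by have h := rp x; rewrite /f; case: (ltnP P (r x)); lia.
have perm_f : perm_eq (map f (iota 1 P)) (iota 1 P).
  have u : uniq (map f (iota 1 P)) by rewrite map_inj_in_uniq // iota_uniq.
  apply: uniq_perm; rewrite ?iota_uniq //.
  have sub : {subset map f (iota 1 P) <= iota 1 P} by move=> _ /mapP[x xP ->]; exact: f_in.
  by case: (uniq_min_size u sub); rewrite ?size_map.
have prod0 : \prod_(1 <= x < P.+1) (x%:R : 'F_p) != 0.
  rewrite prodf_seq_neq0; apply/allP => x; rewrite mem_index_iota => xP.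
  by rewrite -(dvdn_pcharf pF) gtnNdvd; lia.
have s1 : `|(-1 : int) ^+ (\sum_(1 <= x < P.+1) (P < r x))%N| <= 1.
  by rewrite normrX normrN1 expr1n.
apply: (intr_Fp_inj _ _ _ pp op (legendre_bound _ _) s1).
rewrite legendre_euler // rmorphXn rmorphN1 -/P; apply: (mulIf prod0).
have -> : (q%:Z%:~R : 'F_p) = q%:R by [].
have -> : (q%:R : 'F_p) ^+ P = \prod_(1 <= x < P.+1) q%:R by rewrite prodr_const_nat subn1.
rewrite -big_split /=.
under eq_bigr => x _ do rewrite -natrM fE.
rewrite big_split /= prodrXr; congr (_ * _).
rewrite /index_iota subSS subn0 in perm_f *.
by rewrite -[RHS](perm_big _ perm_f) big_map.
Qed.

Lemma sum_nat_rev2 (P Q : nat) (F : nat -> nat -> nat) :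
  (\sum_(1 <= x < P.+1) \sum_(1 <= y < Q.+1) F x y =
   \sum_(1 <= x < P.+1) \sum_(1 <= y < Q.+1) F (P.+1 - x) (Q.+1 - y))%N.
Proof.
rewrite big_nat_rev /=; apply: eq_bigr => x _; rewrite big_nat_rev /=.
by apply: eq_bigr => y _; rewrite !add1n !subSS.
Qed.

(* When the residue of [q x] mod [p] exceeds [p / 2], the only [y] that counts is
   the integer nearest to [q x / p]. *)
Lemma gauss_count (p q x : nat) : odd p -> odd q -> (0 < x <= p./2)%N ->
  ((p./2 < (q * x) %% p) =
   \sum_(1 <= y < q./2.+1) ((q * x < p * y) && (p * y - q * x <= p./2)) :> nat)%N.
Proof.
move=> op oq xP; have pE := odd_double_half p; rewrite op in pE.
have qE := odd_double_half q; rewrite oq in qE.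
set P := p./2 in xP pE *; set Q := q./2 in qE *.
have dE := divn_eq (q * x) p; have rp : ((q * x) %% p < p)%N by rewrite ltn_pmod // -pE.
move: dE rp; set d := (q * x %/ p)%N; set r := ((q * x) %% p)%N => dE rp.
have yE y : (q * x < p * y)%N && (p * y - q * x <= P)%N = (y == d.+1) && (P < r)%N.
  have [->|[l|l]] : y = d.+1 \/ (y <= d)%N \/ (d.+2 <= y)%N by lia.
  - rewrite eqxx /=; nia.
  - have : (p * y <= p * d)%N by rewrite leq_mul2l l orbT.
    lia.
  - have : (p * d.+2 <= p * y)%N by rewrite leq_mul2l l orbT.
    lia.
under eq_bigr => y _ do rewrite yE.
case: (ltnP P r) => Pr; last by rewrite big1 // => y _; rewrite andbF.
(* [p * d + r = q * x <= q * P] and [P < r] give [p * d < 2 * P * Q <= p * Q]. *)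
have dQ : (d.+1 <= Q)%N by nia.
under eq_bigr => y _ do rewrite andbT -[nat_of_bool _]/(if y == d.+1 then 1 else 0)%N.
by rewrite -big_mkcond /= big_nat1_eq /= ltnS dQ.
Qed.

(** Sort the points of the rectangle by the nonzero integer [D = p * y - q * x]. The reflection
    sending [(x, y)] to [(P.+1 - x, Q.+1 - y)] replaces [D] by [P - Q - D], so [P < D] and [D < -Q]
    have equally many points. Modulo 2, the two exponents of Gauss's lemma add up to [P * Q]. *)
Lemma lattice_count (P Q p q : nat) : p = P.*2.+1 -> q = Q.*2.+1 -> coprime p q ->
  (\sum_(1 <= x < P.+1) \sum_(1 <= y < Q.+1) ((q * x < p * y) && (p * y - q * x <= P)) +
   \sum_(1 <= x < P.+1) \sum_(1 <= y < Q.+1) ((p * y < q * x) && (q * x - p * y <= Q)) +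
   (\sum_(1 <= x < P.+1) \sum_(1 <= y < Q.+1) (P + q * x < p * y)).*2 = P * Q)%N.
Proof.
move=> pE qE cpq.
rewrite -addnn [X in (_ + _ + (_ + X))%N]sum_nat_rev2 -!big_split /=.
transitivity (\sum_(1 <= x < P.+1) \sum_(1 <= y < Q.+1) 1)%N; last first.
  by under eq_bigr do rewrite sum_nat_const_nat; rewrite sum_nat_const_nat !subn1 /= muln1.
apply: eq_big_nat => x xP; rewrite -!big_split; apply: eq_big_nat => y yQ /=.
have neq : (q * x != p * y)%N.
  apply/eqP => e; have : (p %| q * x)%N by rewrite e dvdn_mulr.
  by rewrite Gauss_dvdr // gtnNdvd //; lia.
have -> : (P + q * (P.+1 - x) < p * (Q.+1 - y))%N = (Q + p * y < q * x)%N.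
  have [x' xE] : exists x', (P.+1 = x + x')%N by exists (P.+1 - x)%N; lia.
  have [y' yE] : exists y', (Q.+1 = y + y')%N by exists (Q.+1 - y)%N; lia.
  rewrite xE yE !addKn; nia.
lia.
Qed.

Lemma quadratic_reciprocity (p q : nat) :
  prime p -> prime q -> odd p -> odd q -> p != q ->
  legendre q p * legendre p q = (-1) ^+ (p./2 * q./2)%N.
Proof.
move=> pp qq op oq npq.
have cpq : coprime p q by rewrite prime_coprime // dvdn_prime2.
have cqp : coprime q p by rewrite coprime_sym.
have pE : p = p./2.*2.+1 by rewrite -[LHS]odd_double_half op.
have qE : q = q./2.*2.+1 by rewrite -[LHS]odd_double_half oq.
have npq' : ~~ (p %| q)%N by rewrite -prime_coprime.
have nqp' : ~~ (q %| p)%N by rewrite -prime_coprime.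
rewrite (gauss_lemma p q pp op npq') (gauss_lemma q p qq oq nqp') -exprD.
rewrite -(lattice_count _ _ p q pE qE cpq) [in RHS]exprD.
rewrite -muln2 exprM sqrr_sign mulr1; congr (_ ^+ (_ + _)).
  apply: eq_big_nat => x; rewrite ltnS => xP; exact: gauss_count op oq xP.
rewrite exchange_big_nat /=.
apply: eq_big_nat => x; rewrite ltnS => xP; exact: gauss_count oq op xP.
Qed.

Lemma eq_legendre (a b : int) (p : nat) : (a = b %[mod p])%Z -> legendre a p = legendre b p.
Proof.
move=> ab; rewrite /legendre ab.
have -> : (p %| `|a|)%N = (p %| a)%Z by [].
by have -> : (p %| `|b|)%N = (p %| b)%Z by []; rewrite !(sameP dvdz_mod0P eqP) ab.
Qed.

Lemma legendreM (a b : int) (p : nat) : prime p -> odd p ->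
  legendre (a * b) p = legendre a p * legendre b p.
Proof.
move=> pp op; apply: (intr_Fp_inj p) => //; first exact: legendre_bound.
  rewrite normrM -[leRHS]mulr1; apply: ler_pM => //; exact: legendre_bound.
by rewrite rmorphM /= !legendre_euler // rmorphM exprMn.
Qed.

Lemma legendreN1 (p : nat) : prime p -> odd p -> legendre (-1) p = (-1) ^+ p./2.
Proof.
move=> pp op; apply: (intr_Fp_inj p) => //; first exact: legendre_bound.
  by rewrite normrX normrN1 expr1n.
by rewrite legendre_euler // rmorphXn !rmorphN1.
Qed.

Lemma legendre_sqr (a : int) (p : nat) : ~~ (p %| `|a|)%N -> legendre a p ^+ 2 = 1.
Proof. by rewrite /legendre => /negbTE ->; case: ifP. Qed.

(** * The Jacobi symbol and its reciprocity law *)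

Lemma jacobi1r (a : int) : jacobi a 1 = 1.
Proof. by rewrite /jacobi big_nil. Qed.

Lemma jacobi_prime (a : int) (p : nat) : prime p -> jacobi a p = legendre a p.
Proof. by move=> pp; rewrite /jacobi primes_prime // big_seq1 logn_prime // eqxx. Qed.

(** Factors outside [primes n] have exponent 0. A range common to several [n] lets products be
    compared factor by factor. *)
Lemma jacobi_widen (a : int) (n N : nat) : (0 < n < N)%N ->
  jacobi a n = \prod_(0 <= p < N) legendre a p ^+ logn p n.
Proof.
move=> /andP[n0 nN].
rewrite (bigID (mem (primes n))) /= [X in _ * X]big1 ?mulr1; last first.
  by move=> p; rewrite -logn_gt0 lt0n negbK => /eqP ->.
rewrite -big_filter /jacobi; apply: perm_big; apply: uniq_perm => [||p].
- exact: primes_uniq.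
- by rewrite filter_uniq // iota_uniq.
rewrite mem_filter mem_index_iota /= andb_idr // mem_primes => /and3P[_ _ pn].
by rewrite (leq_ltn_trans (dvdn_leq n0 pn)).
Qed.

Lemma jacobiMr (a : int) (m n : nat) : (0 < m)%N -> (0 < n)%N ->
  jacobi a (m * n) = jacobi a m * jacobi a n.
Proof.
move=> m0 n0; rewrite !(jacobi_widen a _ (m * n).+1); try by rewrite ?muln_gt0; nia.
by rewrite -big_split; apply: eq_bigr => p _ /=; rewrite lognM // exprD.
Qed.

Lemma eq_jacobi (a b : int) (n : nat) : (a = b %[mod n])%Z -> jacobi a n = jacobi b n.
Proof.
move=> ab; apply: eq_big_seq => p; rewrite mem_primes => /and3P[_ _ pn].
congr (_ ^+ _); apply: eq_legendre; apply/eqP; rewrite eqz_mod_dvd.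
by apply: dvdz_trans (_ : (n %| a - b)%Z) => //; rewrite -eqz_mod_dvd; apply/eqP.
Qed.

Lemma odd_prime_dvd (p n : nat) : odd n -> p \in primes n -> odd p.
Proof. by rewrite mem_primes => on /and3P[_ _ /dvdn_odd]; apply. Qed.

Lemma jacobiMl (a b : int) (n : nat) : odd n ->
  jacobi (a * b) n = jacobi a n * jacobi b n.
Proof.
move=> on; rewrite -big_split; apply: eq_big_seq => p pn /=.
have := pn; rewrite mem_primes => /and3P[pp _ _].
by rewrite legendreM ?(odd_prime_dvd _ _ on pn) // exprMn.
Qed.

Lemma jacobi_sqr (a : int) (n : nat) : coprime `|a| n -> jacobi a n ^+ 2 = 1.
Proof.
move=> an; rewrite -prodrXl; apply: big1_seq => p /= ; rewrite mem_primes => /and3P[pp _ pn].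
rewrite -exprM mulnC exprM legendre_sqr ?expr1n // -prime_coprime // coprime_sym.
exact: coprime_dvdr an.
Qed.

Lemma odd_prime_ind (P : nat -> Prop) : P 1%N ->
  (forall p n, prime p -> odd p -> odd n -> P n -> P (p * n)%N) ->
  forall n, odd n -> P n.
Proof.
move=> P1 PM n; elim: n {-2}n (leqnn n) => [|N IH] n nN on.
  by move: nN on; rewrite leqn0 => /eqP ->.
have [n1|n1] := leqP n 1; first by have -> : n = 1%N by lia.
have pp := pdiv_prime n1; have := divnK (pdiv_dvd n); rewrite mulnC => nE.
move: on; rewrite -nE oddM => /andP[op om]; apply: PM => //; apply: IH => //.
by rewrite -ltnS (leq_trans _ nN) // ltn_Pdiv // ?prime_gt1 // ltnW.
Qed.

(** Modulo 2, halving turns products of odd numbers into sums, so the signs for -1 and for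
    reciprocity are multiplicative. *)
Lemma half_mul_odd (m n : nat) : odd m -> odd n ->
  (m * n)./2 = ((m./2 * n./2).*2 + (m./2 + n./2))%N.
Proof.
move=> om on; rewrite -{1}(odd_double_half m) -{1}(odd_double_half n) om on.
have -> : ((true + m./2.*2) * (true + n./2.*2) =
  ((m./2 * n./2).*2 + (m./2 + n./2)).*2.+1)%N by nia.
exact: uphalf_double.
Qed.

Lemma jacobiN1 (n : nat) : odd n -> jacobi (-1) n = (-1) ^+ n./2.
Proof.
move: n; apply: odd_prime_ind => [|p n pp op on IH]; first exact: jacobi1r.
rewrite jacobiMr ?odd_gt0 // IH jacobi_prime // legendreN1 // half_mul_odd //.
by rewrite -muln2 exprD exprM sqrr_sign exprD mul1r.
Qed.

Lemma jacobi1l (n : nat) : odd n -> jacobi 1 n = 1.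
Proof.
by move=> on; have := jacobiMl 1 1 n on; rewrite mulr1 -expr2 jacobi_sqr ?coprime1n.
Qed.

Lemma jacobi_reciprocity_mul (p m n : nat) : odd p -> odd m -> odd n ->
  jacobi n p * jacobi p n = (-1) ^+ (p./2 * n./2) ->
  jacobi n m * jacobi m n = (-1) ^+ (m./2 * n./2) ->
  jacobi n (p * m) * jacobi (p * m)%N n = (-1) ^+ ((p * m)./2 * n./2).
Proof.
move=> op om on ep em; rewrite jacobiMr ?odd_gt0 // PoszM jacobiMl // mulrACA ep em.
rewrite half_mul_odd // !mulnDl !exprD.
by rewrite -muln2 [(_ * 2 * _)%N]mulnAC [(-1) ^+ (_ * 2)]exprM sqrr_sign mul1r.
Qed.

Lemma jacobi_reciprocity (m n : nat) : odd m -> odd n -> coprime m n ->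
  jacobi n m * jacobi m n = (-1) ^+ (m./2 * n./2).
Proof.
move=> om on; move: m om; apply: odd_prime_ind => [|p m pp op om IH].
  by rewrite jacobi1r jacobi1l.
rewrite coprimeMl => /andP[cp cm]; apply: jacobi_reciprocity_mul => //; last exact: IH.
(* With [p] prime, a second induction, now on [n], reduces to two primes; the symmetry of the claim
   allows the same multiplicative step. *)
move: n on cp {IH cm}; apply: odd_prime_ind => [|q n qq oq on IH].
  by rewrite jacobi1r jacobi1l // muln0.
rewrite coprimeMr => /andP[cq cn]; rewrite mulrC [(p./2 * _)%N]mulnC.
apply: jacobi_reciprocity_mul => //; last by rewrite mulrC mulnC IH.
rewrite !jacobi_prime // mulrC mulnC; apply: quadratic_reciprocity => //.
by apply: contraTneq cq => ->; rewrite prime_coprime // dvdnn.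
Qed.

Lemma jacobi_flip (m n : nat) : odd m -> odd n -> coprime m n ->
  jacobi m n = (-1) ^+ (m./2 * n./2) * jacobi n m.
Proof.
move=> om on cmn; rewrite -jacobi_reciprocity // mulrAC -expr2 jacobi_sqr ?mul1r //.
by rewrite coprime_sym.
Qed.

(* As [t = -d] modulo [t + d], the second supplementary law is not needed for even [t]. *)
Lemma jacobi_addr (t d : nat) : ~~ odd t -> odd d -> coprime t d ->
  jacobi t (t + d) = (-1) ^+ ((t + d)./2 * d./2.+1) * jacobi t d.
Proof.
move=> et od ctd; have otd : odd (t + d) by rewrite oddD od (negbTE et).
have -> : jacobi t (t + d) = jacobi (-1 * d%:Z) (t + d).
  by apply: eq_jacobi; apply/eqP; rewrite eqz_mod_dvd mulN1r opprK -PoszD.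
rewrite jacobiMl // jacobiN1 // jacobi_flip //; last by rewrite /coprime gcdnDr gcdnC.
rewrite mulrA -exprD -mulSn mulnC; congr (_ * _).
by apply: eq_jacobi; rewrite PoszD modzDr.
Qed.

(** * The continued fraction of exp (1 / n) *)

Section ExpRemainders.
Context {R : realType}.
Implicit Types (z : R) (p q d j : nat).

Lemma is_cvg_series_shift (u : R^nat) :
  cvgn (series u) -> cvgn (series (fun j => u j.+1)).
Proof.
move=> /cvg_ex[l ul]; apply/cvg_ex; exists (l - u 0%N).
have -> : series (fun j => u j.+1) = (fun n => series u n.+1 - u 0%N).
  by apply/funext => n; rewrite /series /= big_nat_recl // addrC addKr.
by apply: cvgB (cvg_cst _); rewrite (cvg_shiftS (series u)).
Qed.

Lemma limn_series_recl (u : R^nat) : cvgn (series u) ->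
  limn (series u) = u 0%N + limn (series (fun j => u j.+1)).
Proof.
move=> cu; apply/cvg_lim => //; rewrite -(cvg_shiftS (series u)).
have -> : [sequence series u n.+1]_n = (fun n => u 0%N + series (fun j => u j.+1) n).
  by apply/funext => n; rewrite /series /= big_nat_recl.
by apply: cvgD (is_cvg_series_shift _ cu); exact: cvg_cst.
Qed.

Lemma limn_series_lin (a b : R) (u v : R^nat) : cvgn (series u) -> cvgn (series v) ->
  limn (series (fun j => a * u j + b * v j)) = a * limn (series u) + b * limn (series v).
Proof.
move=> cu cv; apply/cvg_lim => //.
have -> : series (fun j => a * u j + b * v j) =
    (fun n => a * series u n + b * series v n).
  by apply/funext => n; rewrite /series /= big_split /= !mulr_sumr.
by apply: cvgD; apply: cvgM => //; exact: cvg_cst.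
Qed.

(* The Pade integral [\int_0^1 x^a (1 - x)^b e^(z x) dx] equals
   [b`! * hyp z a (a + b + 1)], by expanding the exponential. *)
Definition hyp_term z p q j : R := (p + j)`!%:R / (j`! * (q + j)`!)%:R * z ^+ j.
Definition hyp z p q : R := limn (series (hyp_term z p q)).

Lemma hyp_term_ge0 z p q j : 0 <= z -> 0 <= hyp_term z p q j.
Proof. by move=> z0; rewrite mulr_ge0 ?exprn_ge0 ?divr_ge0. Qed.

(** Since [(p + j)! <= (q + j)!], the exponential series dominates. *)
Lemma is_cvg_hyp z p q : 0 <= z -> (p <= q)%N -> cvgn (series (hyp_term z p q)).
Proof.
move=> z0 pq; apply: series_le_cvg (is_cvg_series_exp_coeff z).
- by move=> j; exact: hyp_term_ge0.
- by move=> j; exact: exp_coeff_ge0.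
move=> j; rewrite /hyp_term /exp_coeff /= mulrC ler_wpM2l ?exprn_ge0 //.
rewrite natrM invfM mulrA mulrAC -[leRHS]mul1r ler_wpM2r ?invr_ge0 //.
rewrite ler_pdivrMr ?ltr0n ?fact_gt0 // mul1r ler_nat.
by rewrite leq_fact // leq_add2r.
Qed.

Lemma hyp_gt0 z p q : 0 <= z -> (p <= q)%N -> 0 < hyp z p q.
Proof.
move=> z0 pq; have cu := is_cvg_hyp z p q z0 pq.
rewrite /hyp limn_series_recl // ltr_pwDl //.
  by rewrite /hyp_term expr0 mulr1 divr_gt0 // ltr0n ?muln_gt0 ?fact_gt0.
apply: limr_ge; first exact: is_cvg_series_shift.
by apply: nearW => n; apply: sumr_ge0 => i _; exact: hyp_term_ge0.
Qed.

Lemma natr_fact_neq0 j : j`!%:R != 0 :> R.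
Proof. by rewrite pnatr_eq0 -lt0n fact_gt0. Qed.

(** Over a common denominator, the coefficients of [z ^+ j] agree because
    [p + d + 1 + j = (p + 1 + j) + d]. *)
Lemma hyp_succ_succ z p d : 0 <= z ->
  hyp z p (p + d) = hyp z p.+1 (p + d).+1 + d%:R * hyp z p (p + d).+1.
Proof.
move=> z0.
have c1 := is_cvg_hyp z p.+1 (p + d).+1 z0 ltac:(lia).
have c2 := is_cvg_hyp z p (p + d).+1 z0 ltac:(lia).
rewrite -[hyp z p.+1 _]mul1r -limn_series_lin //.
congr (limn (series _)); apply/funext => j.
rewrite /hyp_term !addSn !factS !natrM.
have := natr_fact_neq0 j; have := natr_fact_neq0 (p + d + j).
have : (p + d + j)%:R + 1 != 0 :> R by rewrite natr1 pnatr_eq0.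
rewrite -![_.+1%:R]natr1 !natrD => h1 h2 h3.
by field; rewrite h1 h2 h3.
Qed.

(** The factor [z] shifts the last series by one index; the coefficients of [z ^+ j.+1] then agree
    because [p + 2 + j = (p + 1) + (j + 1)]. *)
Lemma hyp_succ_num z p q : 0 <= z -> (p < q)%N ->
  hyp z p.+1 q = p.+1%:R * hyp z p q + z * hyp z p.+1 q.+1.
Proof.
move=> z0 pq.
have c1 := is_cvg_hyp z p.+1 q z0 pq.
have c2 := is_cvg_hyp z p q z0 (ltnW pq).
have c3 := is_cvg_hyp z p.+1 q.+1 z0 (ltnW pq).
rewrite {1 2}/hyp limn_series_recl // [in RHS]limn_series_recl // mulrDr -addrA.
congr (_ + _).
  by rewrite /hyp_term !expr0 !mulr1 !addn0 factS natrM !mulrA.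
have c2' := is_cvg_series_shift _ c2.
rewrite -limn_series_lin //.
congr (limn (series _)); apply/funext => j.
rewrite /hyp_term !addnS !addSn !factS exprS !natrM.
have := natr_fact_neq0 j; have := natr_fact_neq0 (q + j).
have : (q + j)%:R + 1 != 0 :> R by rewrite natr1 pnatr_eq0.
have : j%:R + 1 != 0 :> R by rewrite natr1 pnatr_eq0.
rewrite -![_.+1%:R]natr1 !natrD => h0 h1 h2 h3.
by field; rewrite h0 h1 h2 h3.
Qed.

Lemma hyp0 z q : 0 <= z -> hyp z 0 q = q`!%:R^-1 + z * hyp z 0 q.+1.
Proof.
move=> z0.
have c1 := is_cvg_hyp z 0 q z0 isT.
have c2 := is_cvg_hyp z 0 q.+1 z0 isT.
rewrite {1}/hyp limn_series_recl //; congr (_ + _).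
  by rewrite /hyp_term expr0 mulr1 !addn0 mul1n mul1r.
(* A zero multiple is added only to give the right side the shape of [limn_series_lin]. *)
rewrite -[RHS]addr0 -(mul0r (hyp z 0 q.+1)) -limn_series_lin //.
congr (limn (series _)); apply/funext => j.
rewrite mul0r addr0 /hyp_term !add0n addnS addSn !factS exprS !natrM.
have := natr_fact_neq0 j; have := natr_fact_neq0 (q + j).
have : (q + j)%:R + 1 != 0 :> R by rewrite natr1 pnatr_eq0.
have : j%:R + 1 != 0 :> R by rewrite natr1 pnatr_eq0.
rewrite -![_.+1%:R]natr1 !natrD => h0 h1 h2 h3.
by field; rewrite h0 h1 h2 h3.
Qed.

Lemma expR_hyp z : expR z = hyp z 0 0.
Proof.
rewrite /expR /hyp; congr (limn (series _)); apply/funext => j.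
by rewrite /hyp_term /exp_coeff /= natrM invfM mulrA divff ?natr_fact_neq0 // mul1r mulrC.
Qed.

End ExpRemainders.

(** Positive digits after the first make [r] strictly decreasing from index 1, so the recurrence is
    Euclidean division and [a k] is the floor of [r k / r k.+1]. *)
Lemma cf_digit_of_remainders (R : realType) (x : R) (r : nat -> R) (a : nat -> nat) :
  x = r 0%N / r 1%N -> (forall k, 0 < r k) -> (forall k, (0 < a k.+1)%N) ->
  (forall k, r k = (a k)%:R * r k.+1 + r k.+2) ->
  forall k, cf_digit x k = (a k)%:Z.
Proof.
move=> xr r0 a0 rec.
have floorE k : Num.floor (r k / r k.+1) = (a k)%:Z.
  apply: floor_def; rewrite rec mulrDl mulfK ?gt_eqF // intrD lerDl ltrD2l.
  rewrite divr_ge0 ?ltW //= ltr_pdivrMr // mul1r [ltRHS]rec.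
  have a1 : 1 <= (a k.+1)%:R :> R by rewrite ler1n.
  by rewrite ltr_pwDr // ler_peMl // ltW.
suff remE k : cf_rem x k = r k / r k.+1 by move=> k; rewrite /cf_digit remE.
elim: k => [//|k IH] /=; rewrite IH floorE.
by rewrite {1}rec mulrDl mulfK ?gt_eqF // addrC addKr invf_div.
Qed.

Definition expR_inv_digit (n k : nat) : nat :=
  if (k %% 3 == 1)%N then ((k %/ 3).*2.+1 * n).-1 else 1%N.

(* [|t_(k-2) e^(1/n) - s_(k-2)|] in the notation of convergents, with the
   absolute values Cohn obtains as integrals of [x^i (1 - x)^j e^(x/n)], where
   [i, j] are [m, m], then [m + 1, m], then [m, m + 1]. *)
Definition expR_inv_remainder (R : realType) (n k : nat) : R :=
  let z := n%:R^-1 in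
  match k with
  | 0%N => expR z
  | 1%N => 1
  | i.+2 => let m := (i %/ 3)%N in z ^+ m.+1 *
      match (i %% 3)%N with
      | 0%N => hyp z m m.*2.+1
      | 1%N => hyp z m.+1 m.*2.+2
      | _ => m.+1%:R * hyp z m m.*2.+2
      end
  end.

Lemma expR_inv_remainder_gt0 (R : realType) (n k : nat) : (0 < n)%N ->
  0 < expR_inv_remainder R n k.
Proof.
move=> n0; have z0 : 0 < n%:R^-1 :> R by rewrite invr_gt0 ltr0n.
case: k => [|[|i]] /=; rewrite ?expR_gt0 // mulr_gt0 ?exprn_gt0 //.
by case: (i %% 3)%N => [|[|?]]; rewrite ?mulr_gt0 ?hyp_gt0 ?(ltW z0) //; lia.
Qed.

Lemma expR_inv_remainderE (R : realType) (n m : nat) (z := n%:R^-1 : R) :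
  [/\ expR_inv_remainder R n (m * 3).+2 = z ^+ m.+1 * hyp z m m.*2.+1,
      expR_inv_remainder R n (m * 3).+3 = z ^+ m.+1 * hyp z m.+1 m.*2.+2 &
      expR_inv_remainder R n (m * 3).+4 = z ^+ m.+1 * (m.+1%:R * hyp z m m.*2.+2)].
Proof.
rewrite /expR_inv_remainder.
have -> : (m * 3 %/ 3 = m)%N by lia.
have -> : ((m * 3).+1 %/ 3 = m)%N by lia.
have -> : ((m * 3).+2 %/ 3 = m)%N by lia.
have -> : (m * 3 %% 3 = 0)%N by lia.
have -> : ((m * 3).+1 %% 3 = 1)%N by lia.
by have -> : ((m * 3).+2 %% 3 = 2)%N by lia.
Qed.

Lemma expR_inv_remainder_rec (R : realType) (n k : nat) : (0 < n)%N ->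
  expR_inv_remainder R n k = (expR_inv_digit n k)%:R * expR_inv_remainder R n k.+1
    + expR_inv_remainder R n k.+2.
Proof.
move=> n0; have : 0 <= n%:R^-1 :> R by rewrite invr_ge0.
have : n%:R * n%:R^-1 = 1 :> R by rewrite divff // pnatr_eq0 -lt0n.
have remE := expR_inv_remainderE R n; move: remE; set z := n%:R^-1 => remE nz z0.
have natr_pred (j : nat) : (0 < j)%N -> j.-1%:R = j%:R - 1 :> R.
  by case: j => // j _; rewrite -natr1 addrK.
(* Indices 0 and 1 involve the initial remainders; from 2 on, the three families of integrals
   alternate. *)
have [k0|[k1|[m [k2|[k3|k4]]]]] : k = 0%N \/ k = 1%N \/
    exists m, k = (m * 3).+2 \/ k = (m * 3).+3 \/ k = (m * 3).+4.
- case: k => [|[|i]]; [by left|by right; left|right; right].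
  by exists (i %/ 3)%N; lia.
- have [/= r2 _ _] := remE 0%N.
  rewrite k0 r2 /= -/z /expR_inv_digit /= expR_hyp (hyp0 z 0) // invr1 expr1; ring.
- have [/= r2 r3 _] := remE 0%N.
  rewrite k1 r2 r3 /= /expR_inv_digit /= natr_pred ?mul1n //.
  have h1 : hyp z 0 1 = hyp z 1 2 + hyp z 0 2.
    by have := hyp_succ_succ z 0 1 z0; rewrite mul1r.
  have h2 : hyp z 0 1 = 1 + z * hyp z 0 2 by rewrite hyp0 // invr1.
  rewrite !expr1 mulrBl !mul1r mulrA nz mul1r.
  have -> : z * hyp z 1 2 = z * hyp z 0 1 - z * hyp z 0 2 by rewrite h1; ring.
  by rewrite h2; ring.
- have [r2 r3 r4] := remE m; rewrite k2 r2 r3 r4 /expR_inv_digit.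
  have -> : ((m * 3).+2 %% 3 == 1)%N = false by lia.
  by have := hyp_succ_succ z m m.+1 z0; rewrite addnS addnn => ->; ring.
- have [_ r3 r4] := remE m; have [r5 _ _] := remE m.+1.
  rewrite k3 -[(m * 3).+3.+2]/(m.+1 * 3).+2 r3 r4 r5 /expR_inv_digit.
  have -> : ((m * 3).+3 %% 3 == 1)%N = false by lia.
  rewrite hyp_succ_num //; last by lia.
  by rewrite doubleS [z ^+ m.+2]exprSr; ring.
- have [_ _ r4] := remE m; have [r5 r6 _] := remE m.+1.
  rewrite k4 -[(m * 3).+4.+1]/(m.+1 * 3).+2 -[(m * 3).+4.+2]/(m.+1 * 3).+3 r4 r5 r6.
  rewrite /expR_inv_digit.
  have -> : ((m * 3).+4 %% 3 == 1)%N by lia.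
  have -> : ((m * 3).+4 %/ 3 = m.+1)%N by lia.
  rewrite natr_pred ?muln_gt0 // natrM !doubleS.
  have h1 : hyp z m m.*2.+2 = hyp z m.+1 m.*2.+3 + m.+2%:R * hyp z m m.*2.+3.
    by have := hyp_succ_succ z m m.+2 z0; rewrite !addnS addnn.
  have h2 : hyp z m.+1 m.*2.+3 = m.+1%:R * hyp z m m.*2.+3 + z * hyp z m.+1 m.*2.+4.
    by apply: hyp_succ_num => //; lia.
  have h3 : hyp z m.+1 m.*2.+3 = hyp z m.+2 m.*2.+4 + m.+2%:R * hyp z m.+1 m.*2.+4.
    by have := hyp_succ_succ z m.+1 m.+2 z0; rewrite !(addnS, addSn) addnn.
  have -> : hyp z m.+2 m.*2.+4 = hyp z m.+1 m.*2.+3 - m.+2%:R * hyp z m.+1 m.*2.+4.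
    by rewrite h3 addrK.
  rewrite h1 [z ^+ m.+2]exprSr.
  move: h2; set A := hyp _ _ _; set D := hyp _ _ _; set E := hyp _ _ _ => h2.
  (* This is the right side with [z ^+ m.+1] factored out. Then [n * z = 1], together with [h2] to
     eliminate [z * E], leaves only [A] and [D]. *)
  transitivity (z ^+ m.+1 *
    (m.*2.+3%:R * (n%:R * z) * A - z * A + z * (A - m.+2%:R * E))); last by ring.
  rewrite nz; have -> : z * (A - m.+2%:R * E) = z * A - m.+2%:R * (A - m.+1%:R * D).
    by rewrite {3}h2; ring.
  rewrite -!natr1 -mul2n natrM; ring.
Qed.

Lemma cf_digit_expR_inv (R : realType) (n k : nat) : (2 <= n)%N ->
  cf_digit (expR (n%:R^-1 : R)) k = (expR_inv_digit n k)%:Z.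
Proof.
move=> n2; apply: (cf_digit_of_remainders _ _ (expR_inv_remainder R n)).
- by rewrite /= divr1.
- by move=> j; apply: expR_inv_remainder_gt0; lia.
(* The smallest digit of the form [(2i + 1) n - 1] is [n - 1], positive as [2 <= n]. *)
- by move=> j; rewrite /expR_inv_digit; case: ifP => // _; nia.
- by move=> j; apply: expR_inv_remainder_rec; lia.
Qed.

(** * Jacobi symbols of consecutive denominators *)

Lemma odd_half (n : nat) : odd n./2 = (1 < n %% 4)%N.
Proof. by lia. Qed.

(** Each addition of [t] to the current [x = a * t + d] costs the sign of [jacobi_addr]. It is 1 if
    4 divides [t]; otherwise it is -1 exactly when [x] is 1 modulo 4. In the latter case [x]
    alternates between 1 and 3 modulo 4, and the halved number counts the visits to 1. *)
Lemma jacobi_muladdr (a t d : nat) : ~~ odd t -> odd d -> coprime t d ->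
  jacobi t (a * t + d) =
  (-1) ^+ ((t %% 4 == 2) && odd ((d %% 4 == 1) + a)./2)%N * jacobi t d.
Proof.
move=> et od ctd; elim: a => [|a IH].
  by rewrite mul0n add0n addn0; case: (d %% 4 == 1)%N; rewrite andbF mul1r.
have od' : odd (a * t + d) by rewrite oddD oddM od (negbTE et) andbF.
have ctd' : coprime t (a * t + d) by rewrite /coprime gcdnMDl.
rewrite mulSn -addnA jacobi_addr // IH mulrA -signr_odd -signr_addb.
congr ((-1) ^+ nat_of_bool _ * _).
rewrite oddM /= {IH ctd ctd'}.
(* With [t] written modulo 4 and [a * T] replaced by a variable, the parity claims become linear. *)
have [T [tE|tE]] : exists T, t = (4 * T)%N \/ t = (4 * T + 2)%N by exists (t %/ 4)%N; lia.
  have xE : (a * t + d = 4 * (a * T) + d)%N by lia.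
  rewrite xE {xE} in od' *; rewrite tE; move: (a * T)%N od' => W; lia.
have xE : (a * t + d = 4 * (a * T) + 2 * a + d)%N by lia.
rewrite xE {xE} in od' *; rewrite tE; move: (a * T)%N od' => W.
have -> : ((4 * T + 2) %% 4 == 2)%N by lia.
have -> : (4 * T + 2 + (4 * W + 2 * a + d) = (2 * (T + W) + a) * 2 + d.+2)%N by lia.
have [D [->|->]] : exists D, d = (4 * D + 1)%N \/ d = (4 * D + 3)%N by exists (d %/ 4)%N; lia.
  have -> : ((4 * D + 1) %% 4 == 1)%N by lia.
  by lia.
have -> : ((4 * D + 3) %% 4 == 1)%N = false by lia.
by lia.
Qed.

(* The Jacobi symbol of consecutive denominators [u], [v] with the odd one at the bottom. *)
Definition jacobi_pair (u v : nat) : int := if odd v then jacobi u v else jacobi v u.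

(** Here [u] and [v] are residues modulo 4. The odd case is the exponent in reciprocity between [v]
    and the next denominator, false if the latter is even; the even case comes from
    [jacobi_muladdr]. *)
Definition jacobi_pair_sign (a u v : nat) : bool :=
  if odd v then (v == 3) && ((a * v + u) %% 4 == 3)%N
  else (v == 2) && odd ((u == 1) + a)./2.

(** The new denominator is [u] modulo [v]. For odd [v] it is reduced to [u], after a flip if it is
    odd; for even [v], [u] is odd and [jacobi_muladdr] applies. *)
Lemma jacobi_pair_step (a u v : nat) : coprime u v ->
  jacobi_pair v (a * v + u) =
  (-1) ^+ jacobi_pair_sign a (u %% 4) (v %% 4) * jacobi_pair u v.
Proof.
move=> cuv; rewrite /jacobi_pair /jacobi_pair_sign.
have -> : odd (v %% 4) = odd v by lia.
have cvw : coprime v (a * v + u) by rewrite /coprime gcdnMDl gcdnC.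
have wE : ((a * (v %% 4) + u %% 4) %% 4 = (a * v + u) %% 4)%N.
  by rewrite modnDmr -modnDml modnMmr modnDml.
have vw : ((a * v + u)%N%:Z = u %[mod v])%Z by rewrite PoszD PoszM modzMDl.
case: (boolP (odd v)) => ov.
  rewrite wE; case: ifPn => ow.
    rewrite jacobi_flip // (eq_jacobi _ _ _ vw) -signr_odd oddM.
    congr ((-1) ^+ nat_of_bool _ * _).
    by lia.
  by rewrite (eq_jacobi _ _ _ vw) andbC; case: eqP => [|_]; [lia|rewrite mul1r].
have ou : odd u.
  apply: contraTT cuv => eu; apply/negP => /eqP g1.
  have : (2 %| gcdn u v)%N by rewrite dvdn_gcd !dvdn2 eu.
  by rewrite g1.
by rewrite oddD oddM (negbTE ov) andbF ou /= jacobi_muladdr // coprime_sym.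
Qed.

Fixpoint cf_dens (a : nat -> nat) (k : nat) : nat * nat :=
  if k is k'.+1 then let: (u, v) := cf_dens a k' in (v, (a k * v + u)%N) else (0, 1)%N.

Lemma cf_conv_aux_dens (R : realType) (x : R) (a : nat -> nat) (k : nat) :
  (forall k, cf_digit x k = a k) ->
  (cf_conv_aux x k).2 = ((cf_dens a k).1%:Z, (cf_dens a k).2%:Z).
Proof.
move=> digitE; elim: k => [//|k] /=; case: (cf_conv_aux x k) => -[sp s] [tp t].
by case: (cf_dens a k) => u v /= [-> ->]; rewrite digitE PoszD PoszM.
Qed.

Lemma cf_conv_aux_det (R : realType) (x : R) (k : nat) :
  let: ((sp, s), (tp, t)) := cf_conv_aux x k in s * tp - sp * t = (-1) ^+ k.+1.
Proof.
elim: k => [|k] /=; first by rewrite mulr0 mulr1 sub0r expr1.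
case: (cf_conv_aux x k) => -[sp s] [tp t] /= h.
by rewrite exprS -h; ring.
Qed.

Lemma coprime_cf_dens (a : nat -> nat) (k : nat) :
  coprime (cf_dens a k).1 (cf_dens a k).2.
Proof.
elim: k => [//|k] /=; case: (cf_dens a k) => u v /= cuv.
by rewrite /coprime gcdnMDl gcdnC.
Qed.

Lemma jacobi_seq_dens (R : realType) (x : R) (a : nat -> nat) (k : nat) :
  (forall k, cf_digit x k = a k) -> jacobi_seq x k =
  let: (u, v) := cf_dens a k in
  if odd v then Some ((-1) ^+ (~~ odd k && (v %% 4 == 3)%N) * jacobi u v) else None.
Proof.
move=> digitE; have := cf_conv_aux_det R x k.
have := cf_conv_aux_dens R x a k digitE; have := coprime_cf_dens a k.
rewrite /jacobi_seq /cf_den /cf_num.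
case: (cf_conv_aux x k) => -[sp s] [tp t]; case: (cf_dens a k) => u v /= cuv [-> ->] det.
rewrite absz_nat; case: ifP => // ov; congr Some.
(* The inserted square of [jacobi u v] is 1, and the determinant identity gives [s * u] modulo
   [v]. *)
have -> : jacobi s v = jacobi (s * u) v * jacobi u v.
  by rewrite jacobiMl // -mulrA -expr2 jacobi_sqr ?mulr1.
congr (_ * _); rewrite (eq_jacobi _ ((-1) ^+ k.+1)); last first.
  by apply/eqP; rewrite eqz_mod_dvd -det opprB addrC subrK dvdz_mull.
rewrite -signr_odd /=; case: (odd k) => /=; first by rewrite jacobi1l.
by rewrite jacobiN1 // -signr_odd; congr ((-1) ^+ nat_of_bool _); lia.
Qed.

(** * The automaton modulo 4 and its periods *)

Fixpoint mod4_state (a : nat -> nat) (k : nat) : nat * nat * bool :=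
  if k is k'.+1 then
    let: (u, v, b) := mod4_state a k' in
    (v, (a k * v + u) %% 4, jacobi_pair_sign (a k) u v (+) b)%N
  else (0, 1, false)%N.

(* The Boolean is the exponent of [-1]; [None] is the symbol [*]. *)
Definition mod4_symbol (a : nat -> nat) (k : nat) : option bool :=
  let: (u, v, b) := mod4_state a k in
  if odd v then Some ((~~ odd k && (v == 3)%N) (+) b) else None.

Lemma mod4_stateE (a : nat -> nat) (k : nat) : let: (u, v) := cf_dens a k in
  let: (u', v', b) := mod4_state a k in
  [/\ u' = u %% 4, v' = v %% 4 & jacobi_pair u v = (-1) ^+ b]%N.
Proof.
elim: k => [|k] /=; first by rewrite /jacobi_pair jacobi1r.
have := coprime_cf_dens a k; case: (cf_dens a k) => u v /= cuv.
case: (mod4_state a k) => -[u' v'] b [-> -> e]; split => //.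
  by rewrite modnDmr -modnDml modnMmr modnDml.
by rewrite jacobi_pair_step // e signr_addb.
Qed.

Lemma jacobi_seq_mod4 (R : realType) (x : R) (a : nat -> nat) :
  (forall k, cf_digit x k = a k) ->
  forall k, jacobi_seq x k = omap (fun b : bool => (-1) ^+ b) (mod4_symbol a k).
Proof.
move=> digitE k; rewrite (jacobi_seq_dens _ _ _ _ digitE) /mod4_symbol.
have := mod4_stateE a k; case: (cf_dens a k) => u v.
case: (mod4_state a k) => -[u' v'] b [_ -> e].
have -> : odd (v %% 4) = odd v by lia.
by move: e; rewrite /jacobi_pair; case: ifP => // _ ->; rewrite /= signr_addb.
Qed.

Lemma eq_mod4_symbol (a a' : nat -> nat) : (forall k, a k = a' k %[mod 4]) ->
  forall k, mod4_symbol a k = mod4_symbol a' k.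
Proof.
move=> aa' k; rewrite /mod4_symbol; suff -> : mod4_state a k = mod4_state a' k by [].
elim: k => [//|k] /= ->; case: (mod4_state a' k) => -[u v] b.
have wE : (a k.+1 * v + u = a' k.+1 * v + u %[mod 4])%N.
  by rewrite -modnDml -modnMml aa' modnMml modnDml.
congr (_, _, _ (+) _) => //; rewrite /jacobi_pair_sign wE; case: ifP => // _.
by congr (_ && _); rewrite !odd_half -modnDmr aa' modnDmr.
Qed.

(** The output also reads the parity of [k], which an even [L] preserves; equal states under equal
    inputs stay equal. *)
Lemma mod4_symbol_period (a : nat -> nat) (L : nat) : ~~ odd L ->
  (forall k, a (k + L).+1 = a k.+1) -> mod4_state a L = mod4_state a 0 ->
  forall k, mod4_symbol a (k + L) = mod4_symbol a k.
Proof.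
move=> eL aL s0 k; rewrite /mod4_symbol oddD (negbTE eL) addbF.
suff -> : mod4_state a (k + L) = mod4_state a k by [].
by elim: k => [//|k IH]; rewrite addSn /= IH aL.
Qed.

(** Adding 3 subtracts 1 modulo 4 without truncation. *)
Definition expR_inv_digit_mod4 (r k : nat) : nat :=
  if (k %% 3 == 1)%N then (((k %/ 3).*2.+1 * r + 3) %% 4)%N else 1%N.

Lemma expR_inv_digitE (n k : nat) : (0 < n)%N ->
  expR_inv_digit n k = expR_inv_digit_mod4 (n %% 4) k %[mod 4].
Proof.
move=> n0; rewrite /expR_inv_digit /expR_inv_digit_mod4; case: ifP => // _.
rewrite modn_mod -modnDml modnMmr modnDml.
have : (0 < (k %/ 3).*2.+1 * n)%N by rewrite muln_gt0.
by move: (_ * n)%N => d d0; lia.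
Qed.

(** A known period [N] confines the test of [L] to one cycle, and a smaller period would pass the
    same test, so minimality is decided by computation. *)
Lemma smallest_period_mod (T : eqType) (c : nat -> T) (N L : nat) :
  (0 < N)%N -> (forall k, c (k + N)%N = c k) -> (0 < L)%N ->
  let period M := all (fun k => c (k + M)%N == c k) (iota 0 N) in
  period L -> ~~ has period (iota 1 L.-1) -> smallest_period_length c L.
Proof.
move=> N0 cN L0 period pL minL; split.
  have cNq q j : c (j + q * N)%N = c j.
    by elim: q => [|q IH]; rewrite ?addn0 // mulSn addnCA addnC cN.
  split=> // k; rewrite (divn_eq k N) -addnA addnC cNq [in RHS]addnC cNq.
  by apply/eqP/(allP pL); rewrite mem_iota /= ltn_mod.
move=> M [M1 cM]; rewrite leqNgt; apply: contra minL => ML.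
apply/hasP; exists M; first by rewrite mem_iota; lia.
by apply/allP => k _; rewrite cM.
Qed.

Theorem theorem4 (R : realType) (n : nat) (hn : (2 <= n)%N) :
  purely_periodic (jacobi_seq (expR (n%:R^-1 : R))) /\
  smallest_period_length (jacobi_seq (expR (n%:R^-1 : R)))
    (if (n %% 4 == 0)%N then 3%N else if (n %% 4 == 2)%N then 12%N else 24%N).
Proof.
set L := (if _ then _ else _); set c := jacobi_seq _.
suff cL : smallest_period_length c L by split=> //; exists L; case: cL.
set s := mod4_symbol (expR_inv_digit_mod4 (n %% 4)).
have cE k : c k = omap (fun b : bool => (-1) ^+ b) (s k).
  rewrite /c (jacobi_seq_mod4 _ _ _ (fun k => cf_digit_expR_inv R n k hn)).
  by congr omap; apply: eq_mod4_symbol => j; apply: expR_inv_digitE; lia.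
have inj : injective (omap (fun b : bool => (-1) ^+ b : int)).
  by move=> [[]|] [[]|].
have per M : is_period_length c M <-> is_period_length s M.
  split=> -[M1 h]; split=> // k; last by rewrite !cE h.
  by apply: inj; rewrite -!cE h.
suff [sL minL] : smallest_period_length s L.
  by split; [exact/per|move=> M /per; exact: minL].
have : (n %% 4 < 4)%N by rewrite ltn_mod.
clear cE per; rewrite {}/L {}/s; move: (n %% 4)%N => r r4.
(* 24 is a period for all four residues [r]: it is a multiple of the digit period 6, and the state
   returns after 24 steps. *)
apply: (smallest_period_mod _ _ 24) => //.
- apply: mod4_symbol_period => // [k|].
    rewrite /expR_inv_digit_mod4 -addSn.
    have -> : ((k.+1 + 24) %% 3 = k.+1 %% 3)%N by lia.
    have -> : ((k.+1 + 24) %/ 3 = k.+1 %/ 3 + 8)%N by lia.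
    by case: ifP => // _; move: (k.+1 %/ 3)%N => m; lia.
  by case: r r4 => [|[|[|[|//]]]] _; vm_compute.
- by case: r r4 => [|[|[|[|//]]]].
- by case: r r4 => [|[|[|[|//]]]] _; vm_compute.
- by case: r r4 => [|[|[|[|//]]]] _; vm_compute.
Qed.
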